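(* Let $X$ be a compact, triangulated space, $A\subset X$ a subspace, $\phi\colon X\to\mathbb{R}$ a continuous function, and $u<v$ real numbers. Then the sequence of homomorphisms of persistent homology groups $$\cdots\longrightarrow H_{k+1}^{u,v}(X,A)\xrightarrow{\ \delta\ }H_k^{u,v}(A)\xrightarrow{\ \alpha\ }H_k^{u,v}(X)\xrightarrow{\ \beta\ }H_k^{u,v}(X,A)\longrightarrow\cdots$$ where $\delta=\delta_k^v|_{\operatorname{Im}h_{k+1}}$, $\alpha=\alpha_k^v|_{\operatorname{Im}f_k}$ and $\beta=\beta_k^v|_{\operatorname{Im}g_k}$, is exact of order $2$. That is, at every position of the sequence, (1) $\operatorname{Im}\delta\subseteq\operatorname{Ker}\alpha$; (2) $\operatorname{Im}\alpha\subseteq\operatorname{Ker}\beta$; (3) $\operatorname{Im}\beta\subseteq\operatorname{Ker}\delta$, where in (3) $\delta$ is the next map $H_k^{u,v}(X,A)\to H_{k-1}^{u,v}(A)$.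
   Context: All homology has coefficients in a fixed field $\mathbf{F}$. For $w\in\mathbb{R}$ the sublevel sets are $X_w=\{x\in X\mid\phi(x)\le w\}$ and $A_w=A\cap X_w$. For each $w$, the long exact homology sequence of the pair $(X_w,A_w)$ consists of $\delta_k^w\colon H_{k+1}(X_w,A_w)\to H_k(A_w)$, the connecting homomorphism $\delta_k^w([c])=[\partial c]$; $\alpha_k^w\colon H_k(A_w)\to H_k(X_w)$, induced by inclusion; and $\beta_k^w\colon H_k(X_w)\to H_k(X_w,A_w)$, induced by the quotient map on chains. For $u<v$ let $f_k\colon H_k(A_u)\to H_k(A_v)$, $g_k\colon H_k(X_u)\to H_k(X_v)$ and $h_k\colon H_k(X_u,A_u)\to H_k(X_v,A_v)$ be the homomorphisms induced by inclusions. The persistent homology groups are their images: $H_k^{u,v}(A)=\operatorname{Im}f_k$, $H_k^{u,v}(X)=\operatorname{Im}g_k$, $H_k^{u,v}(X,A)=\operatorname{Im}h_k$. The maps $\delta,\alpha,\beta$ are the restrictions of $\delta_k^v,\alpha_k^v,\beta_k^v$ to these images, with values in the indicated persistent homology groups. *)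

(* Defs.v *)
From HB Require Import structures.
From mathcomp Require Import freeg zify.
From mathcomp Require Import all_boot all_order all_algebra finmap.
From mathcomp Require Import all_classical all_reals topology normedtype.

Set Implicit Arguments.
Unset Strict Implicit.
Unset Printing Implicit Defensive.

Import Order.TTheory GRing.Theory Num.Theory numFieldNormedType.Exports.

Local Open Scope classical_set_scope.
Local Open Scope ring_scope.
Local Open Scope quotient_scope.

Section Subspace.
Variables (F : fieldType) (V : lmodType F) (S : submodClosed V).

Inductive subspace_of : predArgType := Subspace v & v \in S.

Definition subspace_val w : V := let: Subspace v _ := w in v.
HB.instance Definition _ := [isSub of subspace_of for subspace_val].
HB.instance Definition _ := [Choice of subspace_of by <:].
HB.instance Definition _ :=
  GRing.SubChoice_isSubLmodule.Build F V _ subspace_of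
    (GRing.subsemimodClosedP _).

End Subspace.

Section QuotientSpace.
Variables (F : fieldType) (V : lmodType F) (S : submodClosed V).

Definition zmod_pred : {pred V} := S.

Fact zmod_pred_closed : zmod_closed zmod_pred.
Proof.
split=> [|x y Sx Sy]; first exact: (rpred0 S).
by rewrite /zmod_pred -scaleN1r; apply: rpredD => //; exact: rpredZ.
Qed.
HB.instance Definition _ :=
  GRing.isZmodClosed.Build V zmod_pred zmod_pred_closed.

Definition quotient_space : Type := Quotient.quot zmod_pred.
HB.instance Definition _ := GRing.Zmodule.on quotient_space.
HB.instance Definition _ := Quotient.on quotient_space.

Definition quot_proj (v : V) : quotient_space := \pi_quotient_space v.

Lemma quot_reprK (x : quotient_space) : quot_proj (repr x) = x.
Proof. exact: reprK. Qed.

Lemma quot_projP (x y : V) : reflect (quot_proj x = quot_proj y) (x - y \in S).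
Proof.
rewrite -[_ \in S]/(x - y \in zmod_pred) Quotient.idealrBE; exact: eqP.
Qed.

Lemma quot_projD (u v : V) : quot_proj (u + v) = quot_proj u + quot_proj v.
Proof. exact: (Quotient.pi_add zmod_pred). Qed.

Definition quot_scale (a : F) (x : quotient_space) : quotient_space :=
  quot_proj (a *: (repr x : V)).

Lemma quot_projZ a (v : V) : quot_scale a (quot_proj v) = quot_proj (a *: v).
Proof.
apply/quot_projP; rewrite -scalerBr; apply: rpredZ.
by apply/quot_projP; rewrite quot_reprK.
Qed.

Fact quot_scaleA a b x : quot_scale a (quot_scale b x) = quot_scale (a * b) x.
Proof. by rewrite -(quot_reprK x) (quot_projZ b) !quot_projZ scalerA. Qed.
Fact quot_scale1 : left_id 1 quot_scale.
Proof. by move=> x; rewrite -(quot_reprK x) quot_projZ scale1r. Qed.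
Fact quot_scaleDr : right_distributive quot_scale +%R.
Proof.
move=> a x y; rewrite -(quot_reprK x) -(quot_reprK y) -quot_projD !quot_projZ.
by rewrite scalerDr quot_projD.
Qed.
Fact quot_scaleDl x : {morph quot_scale^~ x : a b / a + b}.
Proof.
by move=> a b; rewrite -(quot_reprK x) !quot_projZ scalerDl quot_projD.
Qed.
HB.instance Definition _ := GRing.Zmodule_isLmodule.Build F quotient_space
  quot_scaleA quot_scale1 quot_scaleDr quot_scaleDl.

Fact quot_proj_linear : linear quot_proj.
Proof. by move=> a u v; rewrite quot_projD -quot_projZ. Qed.
HB.instance Definition _ := GRing.isLinear.Build F V quotient_space _ quot_proj
  quot_proj_linear.

Lemma quot_proj_eq0 (x : V) : (quot_proj x == 0) = (x \in S).
Proof.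
rewrite -[x in RHS]subr0 -(linear0 quot_proj).
by apply/eqP/idP => /quot_projP.
Qed.

End QuotientSpace.

Section KernelImage.
Variables (F : fieldType) (U V : lmodType F) (f : {linear U -> V}).

Definition in_kernel : {pred U} := [pred x | f x == 0].
Definition in_image : {pred V} := [pred y | `[< exists x, f x = y >]].

Fact in_kernel_closed : submod_closed in_kernel.
Proof.
split=> [|a x y]; rewrite !inE ?linear0 // => /eqP fx /eqP fy.
by rewrite linearP fx fy scaler0 addr0.
Qed.
HB.instance Definition _ :=
  GRing.isSubmodClosed.Build F U in_kernel in_kernel_closed.

Lemma in_imageP y : reflect (exists x, f x = y) (y \in in_image).
Proof. exact: asboolP. Qed.

Fact in_image_closed : submod_closed in_image.
Proof.
split=> [|a x y]; first by apply/in_imageP; exists 0; rewrite linear0.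
move=> /in_imageP[x' <-] /in_imageP[y' <-]; apply/in_imageP.
by exists (a *: x' + y'); rewrite linearP.
Qed.
HB.instance Definition _ :=
  GRing.isSubmodClosed.Build F V in_image in_image_closed.

Definition ker : lmodType F := subspace_of in_kernel.
Definition img : lmodType F := subspace_of in_image.
Definition coker : lmodType F := quotient_space in_image.

End KernelImage.

Section UniversalMaps.
Variable F : fieldType.

Section CorestrictKer.
Variables (P U V : lmodType F) (f : {linear U -> V}) (g : {linear P -> U}).
Hypothesis fg0 : forall p, f (g p) = 0.

Fact to_ker_subproof p : g p \in in_kernel f.
Proof. by rewrite inE fg0. Qed.
Definition to_ker (p : P) : ker f := Subspace (to_ker_subproof p).
Fact to_ker_linear : linear to_ker.
Proof. by move=> a x y; apply: val_inj; rewrite /= linearP. Qed.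
HB.instance Definition _ :=
  GRing.isLinear.Build F P (ker f) _ to_ker to_ker_linear.
End CorestrictKer.

Section DescendCoker.
Variables (U V W : lmodType F) (f : {linear U -> V}) (g : {linear V -> W}).

Definition from_coker (_ : forall u, g (f u) = 0) (x : coker f) : W :=
  g (repr x).

Hypothesis gf0 : forall u, g (f u) = 0.
Lemma from_cokerE v : from_coker gf0 (quot_proj (in_image f) v) = g v.
Proof.
apply/eqP; rewrite -subr_eq0 -linearB; apply/eqP.
have /quot_projP/in_imageP[u <-] :=
  quot_reprK (quot_proj (in_image f) v); exact: gf0.
Qed.
Fact from_coker_linear : linear (from_coker gf0).
Proof.
move=> a x y; rewrite -[x]quot_reprK -[y]quot_reprK -linearP !from_cokerE.
by rewrite linearP.
Qed.
HB.instance Definition _ :=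
  GRing.isLinear.Build F (coker f) W _ (from_coker gf0) from_coker_linear.
End DescendCoker.

Section RestrictImage.
Variables (U V U' V' : lmodType F).
Variables (f : {linear U -> V}) (f' : {linear U' -> V'}) (g : {linear V -> V'}).
Hypothesis gf : forall u, g (f u) \in in_image f'.

Fact img_restrict_subproof (y : img f) : g (\val y) \in in_image f'.
Proof. by case: y => y /= /in_imageP[x <-]. Qed.
Definition img_restrict (y : img f) : img f' :=
  Subspace (img_restrict_subproof y).
Fact img_restrict_linear : linear img_restrict.
Proof. by move=> a x y; apply: val_inj; rewrite /= linearP. Qed.
HB.instance Definition _ :=
  GRing.isLinear.Build F (img f) (img f') _ img_restrict img_restrict_linear.
End RestrictImage.

End UniversalMaps.

Section ChainComplexes.
Variable F : fieldType.

Record chain_complex := ChainComplex {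
  chain :> nat -> lmodType F;
  bd : forall k, {linear chain k.+1 -> chain k};
  bd_bd : forall k c, bd k (bd k.+1 c) = 0
}.

(* M_{k-1}, with the convention M_{-1} = 0: complexes and homology groups are
   indexed by nat, those of negative degree being zero. *)
Definition prev_degree (M : nat -> lmodType F) (k : nat) : lmodType F :=
  if k is k'.+1 then M k' else 'rV[F]_0.

Definition prev_degree_map (M N : nat -> lmodType F)
    (f : forall k, {linear M k -> N k}) (k : nat) :
    {linear prev_degree M k -> prev_degree N k} :=
  match k return {linear prev_degree M k -> prev_degree N k} with
  | 0 => \0
  | k'.+1 => f k'
  end.

Section Homology.
Variable C : chain_complex.

Definition bd_prev (k : nat) : {linear C k -> prev_degree C k} :=
  match k return {linear C k -> prev_degree C k} with
  | 0 => \0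
  | k'.+1 => bd C k'
  end.

Definition cycles (k : nat) : lmodType F := ker (bd_prev k).

Fact bd_prev_bd k (c : C k.+1) : bd_prev k (bd C k c) = 0.
Proof. by case: k c => //= k c; exact: bd_bd. Qed.

Definition bd_cycle (k : nat) : {linear C k.+1 -> cycles k} :=
  to_ker (@bd_prev_bd k).

Definition homology (k : nat) : lmodType F := coker (bd_cycle k).

Definition homology_class (k : nat) : {linear cycles k -> homology k} :=
  quot_proj (in_image (bd_cycle k)).

End Homology.

Record chain_map (C D : chain_complex) := ChainMap {
  cmap :> forall k, {linear C k -> D k};
  cmap_bd : forall k c, bd D k (cmap k.+1 c) = cmap k (bd C k c)
}.

Section HomologyMap.
Variables (C D : chain_complex) (phi : chain_map C D).

Fact cycles_map_subproof k (z : cycles C k) :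
  bd_prev D k (phi k (\val z)) = 0.
Proof.
case: z => c /=; rewrite inE => /eqP.
by case: k c => //= k c dc; rewrite cmap_bd dc linear0.
Qed.

Definition cycles_map (k : nat) : {linear cycles C k -> cycles D k} :=
  @to_ker _ _ _ _ _ (phi k \o \val) (@cycles_map_subproof k).

Fact homology_map_subproof k (c : C k.+1) :
  homology_class D k (cycles_map k (bd_cycle C k c)) = 0.
Proof.
apply/eqP; rewrite quot_proj_eq0; apply/in_imageP; exists (phi k.+1 c).
by apply: val_inj; rewrite /= cmap_bd.
Qed.

Definition homology_map (k : nat) : {linear homology C k -> homology D k} :=
  @from_coker _ _ _ _ _ (homology_class D k \o cycles_map k)
    (@homology_map_subproof k).

Lemma homology_mapE k (z : cycles C k) :
  homology_map k (homology_class C k z) = homology_class D k (cycles_map k z).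
Proof. exact: from_cokerE. Qed.

End HomologyMap.

Section QuotientComplex.
Variables (C D : chain_complex) (i : chain_map C D).

Definition quot_chain (k : nat) : lmodType F := coker (i k).
Definition quot_chain_proj (k : nat) : {linear D k -> quot_chain k} :=
  quot_proj (in_image (i k)).

Fact quot_bd_subproof k (a : C k.+1) :
  quot_chain_proj k (bd D k (i k.+1 a)) = 0.
Proof.
apply/eqP; rewrite quot_proj_eq0; apply/in_imageP.
by exists (bd C k a); rewrite cmap_bd.
Qed.

Definition quot_bd (k : nat) : {linear quot_chain k.+1 -> quot_chain k} :=
  @from_coker _ _ _ _ _ (quot_chain_proj k \o bd D k) (@quot_bd_subproof k).

Lemma quot_bdE k (c : D k.+1) :
  quot_bd k (quot_chain_proj k.+1 c) = quot_chain_proj k (bd D k c).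
Proof. exact: from_cokerE. Qed.

Lemma quot_chain_surj k (x : quot_chain k) : exists c, quot_chain_proj k c = x.
Proof. by exists (repr x); exact: quot_reprK. Qed.

Fact quot_bd_bd k (x : quot_chain k.+2) : quot_bd k (quot_bd k.+1 x) = 0.
Proof.
by have [c <-] := quot_chain_surj x; rewrite !quot_bdE bd_bd linear0.
Qed.

Definition quotient_complex := ChainComplex quot_bd_bd.

Definition quotient_map : chain_map D quotient_complex :=
  @ChainMap D quotient_complex quot_chain_proj quot_bdE.

End QuotientComplex.

Record complex_pair := ComplexPair {
  pair_sub : chain_complex;
  pair_tot : chain_complex;
  pair_inc : chain_map pair_sub pair_tot;
  pair_inj : forall k, injective (pair_inc k)
}.

Definition relative_complex (P : complex_pair) := quotient_complex (pair_inc P).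

Record pair_map (P Q : complex_pair) := PairMap {
  pmap_sub : chain_map (pair_sub P) (pair_sub Q);
  pmap_tot : chain_map (pair_tot P) (pair_tot Q);
  pmap_comm : forall k a,
    pmap_tot k (pair_inc P k a) = pair_inc Q k (pmap_sub k a)
}.

Section RelativeMap.
Variables (P Q : complex_pair) (phi : pair_map P Q).

Fact relative_map_subproof k (a : pair_sub P k) :
  quotient_map (pair_inc Q) k (pmap_tot phi k (pair_inc P k a)) = 0.
Proof.
by apply/eqP; rewrite quot_proj_eq0 pmap_comm; apply/in_imageP; eexists.
Qed.

Definition relative_map_fun (k : nat) :
    {linear relative_complex P k -> relative_complex Q k} :=
  @from_coker _ _ _ _ _ (quotient_map (pair_inc Q) k \o pmap_tot phi k)
    (@relative_map_subproof k).

Lemma relative_map_funE k (c : pair_tot P k) :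
  relative_map_fun k (quotient_map (pair_inc P) k c) =
  quotient_map (pair_inc Q) k (pmap_tot phi k c).
Proof. exact: from_cokerE. Qed.

Fact relative_map_bd k (x : relative_complex P k.+1) :
  bd (relative_complex Q) k (relative_map_fun k.+1 x) =
  relative_map_fun k (bd (relative_complex P) k x).
Proof.
have [c <-] := quot_chain_surj x.
rewrite [in LHS]relative_map_funE [LHS]quot_bdE [in RHS]quot_bdE.
by rewrite [RHS]relative_map_funE -cmap_bd.
Qed.

Definition relative_map : chain_map (relative_complex P) (relative_complex Q) :=
  ChainMap relative_map_bd.

End RelativeMap.

Section Connecting.
Variable P : complex_pair.
Local Notation A := (pair_sub P).
Local Notation X := (pair_tot P).
Local Notation i := (pair_inc P).
Local Notation XA := (relative_complex P).
Local Notation q := (quotient_map (pair_inc P)).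
Variable k : nat.

(* y = [bd c] for a chain c of X representing z, where the chain bd c of X is
   identified with the cycle a of A that the inclusion i sends to it. *)
Definition connecting_rel (z : cycles XA k.+1) (y : homology A k) : Prop :=
  exists (c : X k.+1) (a : cycles A k),
    [/\ q k.+1 c = \val z, i k (\val a) = bd X k c & homology_class A k a = y].

Lemma connecting_rel_ex z : exists y, connecting_rel z y.
Proof.
case: z => x /= xk; have [c cx] := quot_chain_surj x.
have : q k (bd X k c) == 0.
  by rewrite -cmap_bd [q _ _]cx; move: xk; rewrite inE.
rewrite quot_proj_eq0 => /in_imageP[a ia].
have ak : a \in in_kernel (bd_prev A k).
  rewrite inE; case: (k) c a ia {cx xk} => [|m] c a ia; first by rewrite /= eqxx.
  by apply/eqP/(@pair_inj P); rewrite linear0 -cmap_bd ia bd_bd.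
by exists (homology_class A k (Subspace ak)), c, (Subspace ak).
Qed.

Lemma connecting_rel_linear (t : F) z y z' y' :
  connecting_rel z y -> connecting_rel z' y' ->
  connecting_rel (t *: z + z') (t *: y + y').
Proof.
move=> [c [a [cz ac <-]]] [c' [a' [cz' ac' <-]]].
by exists (t *: c + c'), (t *: a + a'); rewrite !linearP cz cz' ac ac'.
Qed.

Lemma connecting_rel_bd (x : XA k.+2) y :
  connecting_rel (bd_cycle XA k.+1 x) y -> y = 0.
Proof.
have [d <-] := quot_chain_surj x.
move=> [c [a [+ ac <-]]]; rewrite [RHS]quot_bdE => /quot_projP/in_imageP[b ib].
apply/eqP; rewrite quot_proj_eq0; apply/in_imageP; exists b.
apply: val_inj; apply: (@pair_inj P); rewrite /= -cmap_bd ib ac.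
by rewrite linearB bd_bd subr0.
Qed.

Lemma connecting_rel_uniq z y y' :
  connecting_rel z y -> connecting_rel z y' -> y = y'.
Proof.
move=> zy zy'; apply/eqP; rewrite -subr_eq0 addrC -scaleN1r.
apply/eqP/(@connecting_rel_bd 0).
rewrite (_ : bd_cycle _ _ _ = -1 *: z + z).
  exact: connecting_rel_linear zy' zy.
by rewrite linear0 scaleN1r addNr.
Qed.

Definition connecting_cycles (z : cycles XA k.+1) : homology A k :=
  projT1 (cid (connecting_rel_ex z)).

Lemma connecting_cyclesP z y : connecting_rel z y -> connecting_cycles z = y.
Proof. exact: connecting_rel_uniq (projT2 (cid (connecting_rel_ex z))). Qed.

Fact connecting_cycles_linear : linear connecting_cycles.
Proof.
move=> t z z'; apply: connecting_cyclesP; apply: connecting_rel_linear;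
  exact: (projT2 (cid (connecting_rel_ex _))).
Qed.
HB.instance Definition _ := GRing.isLinear.Build F (cycles XA k.+1)
  (homology A k) _ connecting_cycles connecting_cycles_linear.

Fact connecting_subproof (x : XA k.+2) :
  connecting_cycles (bd_cycle XA k.+1 x) = 0.
Proof.
apply: connecting_rel_bd (projT2 (cid (connecting_rel_ex _))).
Qed.

Definition connecting_succ : {linear homology XA k.+1 -> homology A k} :=
  from_coker connecting_subproof.

Lemma connecting_succE (z : cycles XA k.+1) (c : X k.+1) (a : cycles A k) :
  q k.+1 c = \val z -> i k (\val a) = bd X k c ->
  connecting_succ (homology_class XA k.+1 z) = homology_class A k a.
Proof.
by move=> cz ac; rewrite [LHS]from_cokerE; apply: connecting_cyclesP; exists c, a.
Qed.

End Connecting.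

Definition connecting (P : complex_pair) (k : nat) :
    {linear homology (relative_complex P) k ->
            prev_degree (homology (pair_sub P)) k} :=
  match k return {linear homology (relative_complex P) k ->
                         prev_degree (homology (pair_sub P)) k} with
  | 0 => \0
  | k'.+1 => connecting_succ P k'
  end.

Section Naturality.
Variables (P Q : complex_pair) (phi : pair_map P Q).

Lemma homology_map_inc k x :
  homology_map (pair_inc Q) k (homology_map (pmap_sub phi) k x) =
  homology_map (pmap_tot phi) k (homology_map (pair_inc P) k x).
Proof.
rewrite -(quot_reprK x) -/(homology_class _ _ _) !homology_mapE.
by congr (homology_class _ _ _); apply: val_inj; rewrite /= pmap_comm.
Qed.

Lemma homology_map_quotient k x :
  homology_map (quotient_map (pair_inc Q)) k (homology_map (pmap_tot phi) k x) =
  homology_map (relative_map phi) k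
    (homology_map (quotient_map (pair_inc P)) k x).
Proof.
rewrite -(quot_reprK x) -/(homology_class _ _ _) !homology_mapE.
by congr (homology_class _ _ _); apply: val_inj; exact: esym (relative_map_funE _ _).
Qed.

Lemma connecting_natural k x :
  connecting Q k (homology_map (relative_map phi) k x) =
  prev_degree_map (homology_map (pmap_sub phi)) k (connecting P k x).
Proof.
case: k x => // k x; rewrite -(quot_reprK x) -/(homology_class _ _ _).
move: (repr x) => {x} z.
have [y [c [a [cz ac _]]]] := connecting_rel_ex z.
rewrite [connecting P _ _](connecting_succE cz ac) homology_mapE.
rewrite [RHS]homology_mapE.
apply: (connecting_succE (c := pmap_tot phi k.+1 c)).
  by rewrite -[RHS]/(relative_map_fun phi k.+1 (\val z)) -cz relative_map_funE.
by rewrite /= -pmap_comm ac cmap_bd.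
Qed.

End Naturality.

End ChainComplexes.

(* {freeg K / F} is the free F-module on K; fglift is only shown to be additive
   in the library. *)
Section FreeModule.
Variables (F : fieldType) (K : choiceType) (M : lmodType F) (f : K -> M).

Definition lin_ext (c : {freeg K / F}) : M := fglift f c.

Fact lin_ext_linear : linear lin_ext.
Proof.
have ext_add : {morph lin_ext : c d / c + d}.
  have lin_extB := lift_is_additive f : {morph lin_ext : c d / c - d}.
  move=> c d; have lin_ext0 : lin_ext 0 = 0 by rewrite -(subrr 0) lin_extB subrr.
  by rewrite -[d in LHS]opprK -[- d]add0r !lin_extB lin_ext0 sub0r opprK.
have lin_ext0 : lin_ext 0 = 0.
  by apply: (addrI (lin_ext 0)); rewrite -ext_add !addr0.
have ext_sum s (c : K -> F) :
    lin_ext (\sum_(x <- s) << c x *g x >>) = \sum_(x <- s) c x *: f x.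
  rewrite (big_morph lin_ext ext_add lin_ext0).
  by apply: eq_bigr => x _; exact: liftU.
move=> a c d; rewrite ext_add; congr (_ + _).
rewrite -[in RHS](freeg_sumE c) -[a *: c]/(fgscale a c) /fgscale !ext_sum.
by rewrite scaler_sumr; apply: eq_bigr => x _; rewrite scalerA.
Qed.
HB.instance Definition _ :=
  GRing.isLinear.Build F {freeg K / F} M _ lin_ext lin_ext_linear.

Lemma lin_extE x : lin_ext << x >> = f x.
Proof. by rewrite [LHS]liftU scale1r. Qed.

End FreeModule.

Lemma freeg_linear_eq (F : fieldType) (K : choiceType) (M : lmodType F)
    (f g : {linear {freeg K / F} -> M}) :
  (forall x, f << x >> = g << x >>) -> f =1 g.
Proof.
move=> fg c; rewrite -(freeg_sumE c) !linear_sum; apply: eq_bigr => x _.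
suff -> : << coeff x c *g x >> = coeff x c *: << x >> :> {freeg K / F}.
  by rewrite !linearZ fg.
by apply/eqP/freeg_eqP => y; rewrite coeffZ !coeffU mul1r.
Qed.

Section StandardSimplex.
Variable R : realType.

Definition std_simplex (n : nat) : set 'rV[R]_n.+1 :=
  [set t | (forall i, 0 <= t ord0 i) /\ \sum_i t ord0 i = 1].
Arguments std_simplex : clear implicits.

Definition insert_zero n (i : 'I_n.+2) (t : 'rV[R]_n.+1) : 'rV[R]_n.+2 :=
  \row_j (if unlift i j is Some k then t ord0 k else 0).

Lemma insert_zero_simplex n (i : 'I_n.+2) (t : std_simplex n) :
  insert_zero i (\val t) \in std_simplex n.+1.
Proof.
case: t => t /= /set_mem[t0 t1]; apply/mem_set; split=> [j|].
  by rewrite mxE; case: unliftP.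
rewrite -t1 (bigD1 i) //= mxE unlift_none add0r.
rewrite (reindex_omap (lift i) (unlift i)) => [|j]; last first.
  by case: unliftP => [k -> _|->] //=; rewrite ?eqxx.
apply: eq_big => [k|k _]; last by rewrite mxE liftK.
by rewrite liftK eqxx andbT eq_sym neq_lift.
Qed.

Definition face_fun n (i : 'I_n.+2) (t : std_simplex n) : std_simplex n.+1 :=
  SigSub (insert_zero_simplex i t).

Lemma continuous_mx (T : topologicalType) m n (f : T -> 'M[R]_(m, n)) :
  (forall i j, continuous (fun x => f x i j)) -> continuous f.
Proof.
move=> fc x A [P Px sPA]; apply: (filterS sPA) => /=.
apply: filter_forall => i; apply: filter_forall => j.
exact: (fc i j x _ (Px i j)).
Qed.

Fact face_continuous n (i : 'I_n.+2) : continuous (@face_fun n i).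
Proof.
apply: continuous_comp_initial; apply: continuous_mx => a j.
rewrite (_ : (fun x => _) = fun x : std_simplex n =>
    if unlift i j is Some k then (\val x) ord0 k else 0); last first.
  by apply/funext => x /=; rewrite [a]ord1 mxE.
case: unliftP => [k _|_]; last exact: cst_continuous.
move=> x; apply: (@continuous_comp (std_simplex n) 'rV[R]_n.+1 R set_val
  (fun t : 'rV[R]_n.+1 => t ord0 k)); first exact: initial_continuous.
exact: coord_continuous.
Qed.

Definition face n (i : 'I_n.+2) :
    continuousType (std_simplex n) (std_simplex n.+1) :=
  mkcts (@face_continuous n i).

(* face j \o face i leaves out the vertices j and lift j i; taking them in the
   opposite order gives face (lift j i) \o face (opp_face j i). *)
Definition opp_face n (j : 'I_n.+3) (i : 'I_n.+2) : 'I_n.+2 :=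
  odflt i (unlift (lift j i) j).

Lemma opp_faceP n (j : 'I_n.+3) (i : 'I_n.+2) :
  lift (lift j i) (opp_face j i) = j.
Proof.
rewrite /opp_face; case: unliftP => [k {2}->//|/eqP].
by rewrite (negPf (neq_lift _ _)).
Qed.

Lemma face_face n (j : 'I_n.+3) (i : 'I_n.+2) t :
  face j (face i t) = face (lift j i) (face (opp_face j i) t).
Proof.
apply: val_inj; apply/rowP => m; rewrite !mxE.
have jq := opp_faceP j i; set q := lift j i in jq *; set i' := opp_face j i in jq *.
case: (unliftP j m) => [m' ->|->]; last by rewrite -jq liftK mxE unlift_none.
rewrite mxE; case: (unliftP i m') => [r ->|->]; last by rewrite unlift_none.
suff -> : lift j (lift i r) = lift q (lift i' r) by rewrite liftK mxE liftK.
apply: val_inj; rewrite /= bumpC; congr (bump _ (bump _ _)).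
by have /(congr1 val) := jq; rewrite /= /bump /unbump; lia.
Qed.
End StandardSimplex.
Arguments std_simplex : clear implicits.

Section SingularComplex.
Variables (R : realType) (F : fieldType).

Section Complex.
Variable T : topologicalType.

Definition singular_simplex (n : nat) : choiceType :=
  continuousType (std_simplex R n) T.

Definition simplex_face n (s : singular_simplex n.+1) (i : 'I_n.+2) :
  singular_simplex n := s \o face R i.

Definition singular_chain (n : nat) : lmodType F :=
  {freeg (singular_simplex n) / F}.

Definition singular_bd (n : nat) :
    {linear singular_chain n.+1 -> singular_chain n} :=
  lin_ext (fun s : singular_simplex n.+1 =>
    \sum_(i < n.+2) (-1) ^+ i *: << simplex_face s i >> : singular_chain n).

Fact singular_bd_bd n (c : singular_chain n.+2) :
  singular_bd n (singular_bd n.+1 c) = 0.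
Proof.
pose z : {linear singular_chain n.+2 -> singular_chain n} := \0.
apply: (freeg_linear_eq (f := singular_bd n \o singular_bd n.+1) (g := z)).
move=> s /=; rewrite lin_extE linear_sum.
under eq_bigr => j _ do rewrite linearZ /= lin_extE scaler_sumr.
rewrite pair_bigA /=.
pose G (p : 'I_n.+3 * 'I_n.+2) : singular_chain n :=
  (-1) ^+ p.1 *: ((-1) ^+ p.2 *: << simplex_face (simplex_face s p.1) p.2 >>).
pose h (p : 'I_n.+3 * 'I_n.+2) := (lift p.1 p.2, opp_face p.1 p.2).
have hK : involutive h.
  move=> [j i]; rewrite /h /= opp_faceP; congr (_, _).
  by rewrite {1}/opp_face opp_faceP liftK.
have hval p : ((h p).1 = bump p.1 p.2 :> nat) /\
              (p.1 = bump (bump p.1 p.2) (h p).2 :> nat).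
  by split=> //=; have /(congr1 val)/= -> := opp_faceP p.1 p.2.
have h_lt p : ((h p).2 < (h p).1)%N = ~~ (p.2 < p.1)%N.
  by have := hval p; rewrite /bump; lia.
have Gh p : G (h p) = - G p.
  rewrite /G !scalerA -!exprD.
  have -> : simplex_face (simplex_face s (h p).1) (h p).2 =
            simplex_face (simplex_face s p.1) p.2.
    by apply/continuousEP => t; rewrite /= -face_face.
  rewrite -scaleNr -signr_odd -[in RHS]signr_odd -signrN.
  have -> : odd ((h p).1 + (h p).2) = ~~ odd (p.1 + p.2).
    by have := hval p; rewrite /bump; lia.
  by [].
rewrite -/(\sum_p G p) (bigID (fun p : 'I_n.+3 * 'I_n.+2 => p.2 < p.1)%N) /=.
rewrite [X in _ + X](reindex_inj (inv_inj hK)) /=.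
under [X in _ + X]eq_bigl => p do rewrite -/(h p).2 -/(h p).1 h_lt negbK.
under [X in _ + X]eq_bigr => p _ do rewrite Gh.
by rewrite sumrN subrr.
Qed.

Definition singular_complex : chain_complex F := ChainComplex singular_bd_bd.

End Complex.

Section Push.
Variables (S T : topologicalType) (f : continuousType S T).

Definition push_simplex n (s : singular_simplex S n) : singular_simplex T n :=
  f \o s.

Definition push_chain (n : nat) :
    {linear singular_chain S n -> singular_chain T n} :=
  lin_ext (fun s => << push_simplex s >> : singular_chain T n).

Fact push_chain_bd n (c : singular_complex S n.+1) :
  singular_bd T n (push_chain n.+1 c) = push_chain n (singular_bd S n c).
Proof.
move: c; apply: (freeg_linear_eq (f := singular_bd T n \o push_chain n.+1)
  (g := push_chain n \o singular_bd S n)) => s /=.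
rewrite !lin_extE linear_sum; apply: eq_bigr => i _.
by rewrite linearZ /= lin_extE; congr (_ *: << _ >>); apply/continuousEP.
Qed.

Definition singular_map : chain_map (singular_complex S) (singular_complex T) :=
  @ChainMap _ (singular_complex S) (singular_complex T) push_chain push_chain_bd.

Lemma push_chain_inj n : injective f -> injective (push_chain n).
Proof.
move=> f_inj.
have p_inj : injective (@push_simplex n).
  by move=> s t /continuousEP st; apply/continuousEP => x; exact/f_inj/st.
pose coef_at (U : topologicalType) (s : singular_simplex U n) :
    {linear singular_chain U n -> F^o} := lin_ext (fun t => (t == s)%:R : F^o).
suff coef c s : coeff (push_simplex s) (push_chain n c) = coeff s c.
  by move=> c d cd; apply/eqP/freeg_eqP => s; rewrite -!coef cd.
apply: (freeg_linear_eq (f := coef_at T (push_simplex s) \o push_chain n)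
  (g := coef_at S s)) => t /=.
by rewrite !lin_extE (inj_eq p_inj).
Qed.

End Push.
End SingularComplex.

Section Inclusion.
Variables (T : topologicalType) (A B : set T) (AB : A `<=` B).

Definition inclusion_fun (x : A) : B := SigSub (mem_set (AB (set_valP x))).

Fact inclusion_continuous : continuous inclusion_fun.
Proof. by apply: continuous_comp_initial; exact: initial_continuous. Qed.

Definition inclusion : continuousType A B := mkcts inclusion_continuous.

Lemma inclusion_inj : injective inclusion.
Proof. by move=> x y /(congr1 val) xy; exact: val_inj. Qed.

End Inclusion.

Section SingularPair.
Variables (R : realType) (F : fieldType) (T : topologicalType).

Definition singular_pair (A B : set T) (AB : A `<=` B) : complex_pair F :=
  @ComplexPair F _ _ (singular_map R F (inclusion AB))
    (fun k => @push_chain_inj R F _ _ _ k (@inclusion_inj T A B AB)).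

Section PairInclusion.
Variables (A B A' B' : set T).
Variables (AB : A `<=` B) (AB' : A' `<=` B').
Variables (AA' : A `<=` A') (BB' : B `<=` B').

Fact pair_inclusion_comm k (a : singular_complex R F A k) :
  singular_map R F (inclusion BB') k (singular_map R F (inclusion AB) k a) =
  singular_map R F (inclusion AB') k (singular_map R F (inclusion AA') k a).
Proof.
move: a; apply: (freeg_linear_eq
  (f := push_chain R F (inclusion BB') k \o push_chain R F (inclusion AB) k)
  (g := push_chain R F (inclusion AB') k \o push_chain R F (inclusion AA') k)).
move=> s /=; rewrite !lin_extE; congr << _ >>.
by apply/continuousEP => t; apply: val_inj.
Qed.

Definition pair_inclusion : pair_map (singular_pair AB) (singular_pair AB') :=
  @PairMap F (singular_pair AB) (singular_pair AB') _ _ pair_inclusion_comm.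

End PairInclusion.
End SingularPair.

Section Triangulation.
Variable R : realType.

Record simplicial_complex (V : choiceType) := SimplicialComplex {
  simplices : set {fset V};
  simplices_neq0 : forall s, simplices s -> s != fset0;
  simplices_sub : forall s t, simplices s -> fsubset t s -> t != fset0 ->
    simplices t
}.

Section Realization.
Variables (V : choiceType) (K : simplicial_complex V).

(* Points are given by their barycentric coordinates. *)
Definition closed_simplex (s : {fset V}) : set (V -> R) :=
  [set t | [/\ forall v, 0 <= t v, forall v, v \notin s -> t v = 0 &
               \sum_(v <- s) t v = 1]].

Definition realization : Type :=
  {t : V -> R | exists2 s, simplices K s & closed_simplex s t}.

HB.instance Definition _ := gen_eqMixin realization.
HB.instance Definition _ := gen_choiceMixin realization.

(* The weak topology: U is open iff its trace on every closed simplex is open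
   for the Euclidean topology of that simplex. *)
Definition realization_open : set (set realization) :=
  [set U | forall s x, simplices K s -> closed_simplex s (sval x) -> U x ->
    exists2 e, 0 < e & forall y, closed_simplex s (sval y) ->
      (forall v, v \in s -> `|sval x v - sval y v| < e) -> U y].

Fact realization_openT : realization_open setT.
Proof. by move=> s x _ _ _; exists 1. Qed.

Fact realization_openI : setI_closed realization_open.
Proof.
move=> U W Uo Wo s x Ks sx [Ux Wx].
have [d d0 dU] := Uo s x Ks sx Ux; have [e e0 eW] := Wo s x Ks sx Wx.
exists (Num.min d e) => [|y sy xy]; first by rewrite lt_min d0.
by split; [apply: dU|apply: eW] => // v vs; have := xy v vs;
  rewrite lt_min => /andP[].
Qed.

Fact realization_open_bigU (I : Type) (U : I -> set realization) :
  (forall i, realization_open (U i)) -> realization_open (\bigcup_i U i).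
Proof.
move=> Uo s x Ks sx [i _ Uix]; have [e e0 eU] := Uo i s x Ks sx Uix.
by exists e => // y sy xy; exists i => //; exact: eU.
Qed.

HB.instance Definition _ := isOpenTopological.Build realization
  realization_openT realization_openI realization_open_bigU.

End Realization.

Definition triangulated (X : topologicalType) : Prop :=
  exists (V : choiceType) (K : simplicial_complex V)
         (h : realization K -> X) (h' : X -> realization K),
    [/\ cancel h h', cancel h' h, continuous h & continuous h'].

End Triangulation.

Section Persistence.
Variables (R : realType) (F : fieldType) (X : topologicalType) (A : set X).
Variable phi : X -> R.

Definition sublevel (w : R) : set X := [set x | phi x <= w].

(* The singular chain complexes of A_w and X_w, as topological subspaces of X. *)
Definition sublevel_pair (w : R) : complex_pair F :=
  singular_pair R F (@subIsetr X A (sublevel w)).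

Section LongSequence.
Variable w : R.

Definition H_A (k : nat) : lmodType F :=
  homology (singular_complex R F (A `&` sublevel w)) k.
Definition H_X (k : nat) : lmodType F :=
  homology (singular_complex R F (sublevel w)) k.
Definition H_XA (k : nat) : lmodType F :=
  homology (relative_complex (sublevel_pair w)) k.

(* delta_{k-1}^w, with source in degree k. *)
Definition delta (k : nat) : {linear H_XA k -> prev_degree H_A k} :=
  connecting (sublevel_pair w) k.
Definition alpha (k : nat) : {linear H_A k -> H_X k} :=
  homology_map (pair_inc (sublevel_pair w)) k.
Definition beta (k : nat) : {linear H_X k -> H_XA k} :=
  homology_map (quotient_map (pair_inc (sublevel_pair w))) k.

End LongSequence.

Variables (u v : R) (ltuv : u < v).

Fact sublevel_subset : sublevel u `<=` sublevel v.
Proof. by move=> x /le_trans; apply; exact: ltW. Qed.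

Definition sublevel_map : pair_map (sublevel_pair u) (sublevel_pair v) :=
  pair_inclusion R F (@subIsetr X A (sublevel u)) (@subIsetr X A (sublevel v))
    (@setIS X A _ _ sublevel_subset) sublevel_subset.

(* f_k, g_k and h_k *)
Definition map_A (k : nat) : {linear H_A u k -> H_A v k} :=
  homology_map (pmap_sub sublevel_map) k.
Definition map_X (k : nat) : {linear H_X u k -> H_X v k} :=
  homology_map (pmap_tot sublevel_map) k.
Definition map_XA (k : nat) : {linear H_XA u k -> H_XA v k} :=
  homology_map (relative_map sublevel_map) k.

Definition PH_A (k : nat) : lmodType F := img (map_A k).
Definition PH_X (k : nat) : lmodType F := img (map_X k).
Definition PH_XA (k : nat) : lmodType F := img (map_XA k).

Fact pers_delta_subproof k (x : H_XA u k.+1) :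
  delta v k.+1 (map_XA k.+1 x) \in in_image (map_A k).
Proof.
apply/in_imageP; exists (delta u k.+1 x).
exact: esym (connecting_natural sublevel_map x).
Qed.

Fact pers_alpha_subproof k (x : H_A u k) :
  alpha v k (map_A k x) \in in_image (map_X k).
Proof.
apply/in_imageP; exists (alpha u k x).
exact: esym (homology_map_inc sublevel_map x).
Qed.

Fact pers_beta_subproof k (x : H_X u k) :
  beta v k (map_X k x) \in in_image (map_XA k).
Proof.
apply/in_imageP; exists (beta u k x).
exact: esym (homology_map_quotient sublevel_map x).
Qed.

(* The restriction of delta_{k-1}^v, with source in degree k. *)
Definition pers_delta (k : nat) : {linear PH_XA k -> prev_degree PH_A k} :=
  match k return {linear PH_XA k -> prev_degree PH_A k} with
  | 0 => \0
  | k'.+1 => img_restrict (@pers_delta_subproof k')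
  end.
Definition pers_alpha (k : nat) : {linear PH_A k -> PH_X k} :=
  img_restrict (@pers_alpha_subproof k).
Definition pers_beta (k : nat) : {linear PH_X k -> PH_XA k} :=
  img_restrict (@pers_beta_subproof k).

End Persistence.

(* Main.v *)
Require Import Defs.
From mathcomp Require Import all_boot all_order all_algebra.
From mathcomp Require Import all_classical all_reals topology normedtype.

(** The persistent sequence is a sequence of subspaces of the long exact
sequence of the pair at the level [v], with the restricted maps: every
element of an image group lies in a homology group of level [v], and
[delta], [alpha], [beta] act on it as the maps of that level do.  Composing
two consecutive maps therefore gives zero as soon as it does so in the long
exact sequence.  This survives restriction, while exactness does not: an
element of a persistent group that is killed at level [v] has a preimage at
level [v], which need not come from level [u].

The vanishing of the composites holds for every pair of chain complexes
([homology_inc_connecting], [homology_quotient_inc],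
[connecting_homology_quotient]) and is seen on representatives. *)

Import Order.TTheory GRing.Theory Num.Theory numFieldNormedType.Exports.

Local Open Scope classical_set_scope.
Local Open Scope ring_scope.

Lemma homology_class_surj (F : fieldType) (C : chain_complex F) (k : nat)
    (x : homology C k) :
  exists z, homology_class C k z = x.
Proof. by exists (repr x); exact: quot_reprK. Qed.

(** The connecting map sends a relative class to a cycle of the subcomplex that
becomes the boundary [bd c] in the total complex. *)
Lemma homology_inc_connecting (F : fieldType) (P : complex_pair F) (k : nat)
    (x : homology (relative_complex P) k.+1) :
  homology_map (pair_inc P) k (connecting P k.+1 x) = 0.
Proof.
have [z <-] := homology_class_surj _ _ _ x.
have [y [c [a [cz ac _]]]] := connecting_rel_ex z.
rewrite [connecting P _ _](connecting_succE cz ac) homology_mapE.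
apply/eqP; rewrite quot_proj_eq0; apply/in_imageP; exists c.
by apply: val_inj; rewrite /= ac.
Qed.

(** Chains of the subcomplex already vanish in the quotient complex. *)
Lemma homology_quotient_inc (F : fieldType) (P : complex_pair F) (k : nat)
    (x : homology (pair_sub P) k) :
  homology_map (quotient_map (pair_inc P)) k
    (homology_map (pair_inc P) k x) = 0.
Proof.
have [z <-] := homology_class_surj _ _ _ x.
rewrite !homology_mapE -[RHS](linear0 (homology_class _ _)).
congr (homology_class _ _ _); apply: val_inj => /=.
by apply/eqP; rewrite quot_proj_eq0; apply/in_imageP; exists (\val z).
Qed.

(** A relative class coming from an absolute cycle is represented by that
cycle, whose boundary is the image of the zero chain of the subcomplex. *)
Lemma connecting_homology_quotient (F : fieldType) (P : complex_pair F)
    (k : nat) (x : homology (pair_tot P) k) :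
  connecting P k (homology_map (quotient_map (pair_inc P)) k x) = 0.
Proof.
case: k x => // k x.
have [z <-] := homology_class_surj _ _ _ x.
rewrite homology_mapE -[RHS](linear0 (homology_class (pair_sub P) k)).
apply: (connecting_succE (c := \val z)) => //.
rewrite !linear0; case: z => c /=.
by rewrite inE => /eqP ->.
Qed.

Theorem proposition4p3 (R : realType) (F : fieldType) (X : topologicalType)
    (A : set X) (phi : X -> R) (u v : R) (ltuv : u < v) :
  compact [set: X] -> triangulated R X -> continuous phi ->
  forall k : nat,
  [/\ range (pers_delta F A phi ltuv k.+1) `<=`
        pers_alpha F A phi ltuv k @^-1` [set 0],
      range (pers_alpha F A phi ltuv k) `<=`
        pers_beta F A phi ltuv k @^-1` [set 0] &
      range (pers_beta F A phi ltuv k) `<=`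
        pers_delta F A phi ltuv k @^-1` [set 0]].
Proof.
move=> _ _ _ k; split.
- move=> _ [x _ <-]; apply: val_inj.
  exact: (homology_inc_connecting _ (sublevel_pair F A phi v)).
- move=> _ [x _ <-]; apply: val_inj.
  exact: (homology_quotient_inc _ (sublevel_pair F A phi v)).
- move=> _ [x _ <-]; case: k x => // k x; apply: val_inj.
  exact: (connecting_homology_quotient _ (sublevel_pair F A phi v) k.+1).
Qed.
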